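(* For all integers $n,\alpha,\beta\ge0$ and $r,s\in\mathbb{Z}$, $${n-\beta\choose\alpha}_r+{n-\alpha\choose\beta}_s={n\choose\alpha+\beta}_{r+s}+\sum_{k=0}^{n}\ \sum_{\substack{\ell,m\ge0\\ \ell+m=k-1}}{n\choose k}_{r+s}{\ell\choose\alpha}_r{m\choose\beta}_s.$$
   Context: The Euler polynomials $E_n(x)$ are defined by $\frac{2e^{xt}}{e^t+1}=\sum_{n\ge0}E_n(x)\frac{t^n}{n!}$. For integers $N\ge0$, define ${N\brack j}$ by $\sum_{j=1}^N{N\brack j}x^{2j-1}=x^{2N}-E_{2N}(x)$ and ${N\brace j}$ by $\sum_{j=0}^N{N\brace j}x^{2j}=x^{2N+1}-E_{2N+1}(x)$; set ${N\brack j}=0$ if $j\le0$ or $j>N$, ${N\brace j}=0$ if $j<0$ or $j>N$. For $r\in\mathbb{Z}$ and integers $0\le i\le n$ define $${n\choose i}_r:=\begin{cases}{r/2+n\brack r/2+i}, & r\text{ even},\ n\ge\max\{0,-r/2\},\\ -{-r/2-i\brack -r/2-n}, & r\text{ even},\ 0\le n<-r/2,\\ {(r-1)/2+n\brace (r-1)/2+i}, & r\text{ odd},\ n\ge\max\{0,-(r-1)/2\},\\ -{-(r+1)/2-i\brace -(r+1)/2-n}, & r\text{ odd},\ 0\le n<-(r-1)/2,\end{cases}$$ and set ${n\choose i}_r:=0$ whenever $n<0$, $i<0$ or $i>n$. (Equivalently, for $0\le i\le n$, ${n\choose i}_r=f_{n-i+1}\binom{r+2n}{r+2i-1}$ if $n\ge\max\{0,\lceil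 -r/2\rceil\}$ and $-f_{n-i+1}\binom{-r-2i}{-r-2n-1}$ if $0\le n<\lceil -r/2\rceil$, where $f_m=\frac{4^m-1}{m}B_{2m}$ and $B_j$ are the Bernoulli numbers.) *)

(* Defs.v *)
From HB Require Import structures.
From mathcomp Require Import all_boot all_order all_algebra.
Set Implicit Arguments. Unset Strict Implicit. Unset Printing Implicit Defensive.
Import Order.TTheory GRing.Theory Num.Theory.
Local Open Scope ring_scope.

(* Euler polynomials E_n(x) over rat.  Comparing coefficients of t^n in
   2 e^{xt} = (e^t + 1) * sum_n E_n(x) t^n/n!  gives
   2 x^n = E_n(x) + sum_{k<=n} C(n,k) E_k(x), i.e.
   E_n(x) = x^n - 1/2 * sum_{k<n} C(n,k) E_k(x).
   euler_seq n = [:: E_0; ...; E_n]. *)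
Fixpoint euler_seq (n : nat) : seq {poly rat} :=
  match n with
  | 0 => [:: 1]
  | n'.+1 =>
      let s := euler_seq n' in
      rcons s ('X^n - 2^-1 *: \sum_(k < n) ('C(n, k))%:R *: nth 0 s k)
  end.

Definition euler (n : nat) : {poly rat} := nth 0 (euler_seq n) n.

Definition ebrack (N j : int) : rat :=
  if (0 <= N) && (1 <= j) && (j <= N) then
    ('X^(2 * `|N|%N) - euler (2 * `|N|%N))`_(2 * `|j|%N - 1)
  else 0.

Definition ebrace (N j : int) : rat :=
  if (0 <= N) && (0 <= j) && (j <= N) then
    ('X^((2 * `|N|%N).+1) - euler ((2 * `|N|%N).+1))`_(2 * `|j|%N)
  else 0.

(* the r-binomial  (n choose i)_r ; h = floor(r/2), so h = r/2 for r even
   and h = (r-1)/2 for r odd (then -(r+1)/2 = -h-1). *)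
Definition rbinom (r n i : int) : rat :=
  if (n < 0) || (i < 0) || (n < i) then 0 else
  let h := (r %/ 2)%Z in
  if (r %% 2)%Z == 0 then
    (if Num.max 0 (- h) <= n then ebrack (h + n) (h + i)
     else - ebrack (- h - i) (- h - n))
  else
    (if Num.max 0 (- h) <= n then ebrace (h + n) (h + i)
     else - ebrace (- h - 1 - i) (- h - 1 - n)).

(* Main.v *)
Require Import Defs.
From HB Require Import structures.
From mathcomp Require Import all_boot all_order all_algebra.
From mathcomp Require Import ring zify.
Import Order.TTheory GRing.Theory Num.Theory.
Local Open Scope ring_scope.

(** Write tanh(t/2) = sum_m c_m t^(2m+1) and let (u)_k be the rising factorial.
    Since x^n - E_n(x) = tanh(D/2) x^n, all four cases of the definition give, for
    0 <= i <= n, the single formula (n choose i)_r = c_(n-i) (r + 2i)_(2(n-i)+1).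
    The linear form x^i y^j |-> (u)_i (v)_j maps (x + y)^k x^i y^j to
    (u)_i (v)_j (u + v + i + j)_k (Vandermonde).  Applied with u = r + 2 alpha and
    v = s + 2 beta to the homogeneous components of
    tanh x + tanh y = tanh (x + y) (1 + tanh x tanh y), it yields the theorem. *)

(** * Truncated exponential series; congruence modulo t^M is divisibility by ['X^M] *)

Lemma dvdXnP (F : fieldType) (M : nat) (p : {poly F}) :
  reflect (forall k, (k < M)%N -> p`_k = 0) ('X^M %| p).
Proof.
rewrite /dvdp -Pdiv.IdomainMonic.take_poly_modp.
apply: (iffP eqP) => [p0 k kM | p0].
  by have := congr1 (fun q : {poly F} => q`_k) p0; rewrite coef_take_poly kM coef0.
by apply/polyP => k; rewrite coef_take_poly coef0; case: ifP => // /p0.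
Qed.

Lemma coef_dilate (R : comNzRingType) (p : {poly R}) (x : R) k :
  (p \Po (x *: 'X))`_k = p`_k * x ^+ k.
Proof.
rewrite comp_polyE coef_sum; under eq_bigr do rewrite exprZn !coefZ coefXn.
case: (ltnP k (size p)) => kp.
  rewrite (bigD1 (Ordinal kp)) //= eqxx mulr1 big1 ?addr0 // => i ik.
  by move: ik; rewrite -val_eqE /= eq_sym => /negPf->; rewrite !mulr0.
rewrite nth_default // mul0r big1 // => i _.
by rewrite gtn_eqF ?mulr0 ?mulr0 // (leq_trans (ltn_ord i)).
Qed.

Lemma dvdXn_dilate (F : fieldType) M (p : {poly F}) x :
  'X^M %| p -> 'X^M %| p \Po (x *: 'X).
Proof.
by move/dvdXnP=> p0; apply/dvdXnP => k kM; rewrite coef_dilate p0 ?mul0r.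
Qed.

Lemma fact_rat_neq0 n : n`!%:R != 0 :> rat.
Proof. by rewrite pnatr_eq0 -lt0n fact_gt0. Qed.

Definition exp_trunc (M : nat) : {poly rat} := \poly_(k < M) (k`!%:R)^-1.

(** The binomial theorem, read coefficientwise in e^(xt) e^(yt) = e^((x+y)t). *)
Lemma exp_trunc_add M (x y : rat) :
  'X^M %| (exp_trunc M \Po (x *: 'X)) * (exp_trunc M \Po (y *: 'X))
          - (exp_trunc M \Po ((x + y) *: 'X)).
Proof.
apply/dvdXnP => k kM; apply/eqP; rewrite coefB subr_eq0 coefM coef_dilate.
rewrite coef_poly kM addrC exprDn mulr_sumr; apply/eqP; apply: eq_bigr => j _.
have jk : (j <= k)%N by rewrite -ltnS.
rewrite !coef_dilate !coef_poly (leq_ltn_trans jk kM).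
rewrite (leq_ltn_trans (leq_subr _ _) kM).
have f0 := fact_rat_neq0.
rewrite -mulr_natr -(bin_fact jk) !natrM.
have b0 : 'C(k, j)%:R != 0 :> rat by rewrite pnatr_eq0 -lt0n bin_gt0.
by field; rewrite !f0 b0.
Qed.

(** * Coefficients of the Euler polynomials *)

Definition euler0 (n : nat) : rat := (euler n)`_0.

Lemma size_euler_seq n : size (euler_seq n) = n.+1.
Proof. by elim: n => //= n IHn; rewrite size_rcons IHn. Qed.

Lemma nth_euler_seq n k : (k <= n)%N -> nth 0 (euler_seq n) k = euler k.
Proof.
elim: n => [|n IHn]; first by rewrite leqn0 => /eqP->.
rewrite leq_eqVlt => /predU1P[-> //|kn].
by rewrite -IHn //= nth_rcons size_euler_seq kn.
Qed.

Lemma eulerE n :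
  euler n = 'X^n - 2^-1 *: \sum_(k < n) ('C(n, k))%:R *: euler k.
Proof.
case: n => [|n]; first by rewrite big_ord0 scaler0 subr0.
rewrite {1}/euler /= nth_rcons size_euler_seq ltnn eqxx.
by congr (_ - _ *: _); apply: eq_bigr => k _; rewrite nth_euler_seq // -ltnS.
Qed.

Lemma euler0E n :
  euler0 n = (n == 0%N)%:R - 2^-1 * \sum_(k < n) ('C(n, k))%:R * euler0 k.
Proof.
rewrite /euler0 eulerE coefB coefXn coefZ coef_sum eq_sym.
by under eq_bigr do rewrite coefZ.
Qed.

Lemma mul_bin_bin j d k : (k <= d)%N ->
  ('C(j + d, j + k) * 'C(j + k, j) = 'C(j + d, j) * 'C(d, k))%N.
Proof.
move=> kd; apply/eqP.
rewrite -(eqn_pmul2r (fact_gt0 j)) -(eqn_pmul2r (fact_gt0 k)).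
rewrite -(eqn_pmul2r (fact_gt0 (d - k))); apply/eqP.
have := bin_fact (leq_addr k j); have := bin_fact (leq_addr d j).
have := bin_fact kd; have := @bin_fact (j + d) (j + k).
rewrite leq_add2l subnDl !addKn => /(_ kd) e1 e2 e3 e4.
transitivity ((j + d)`!)%N; first by rewrite -e1 -e4; ring.
by rewrite -e3 -e2; ring.
Qed.

(** The Appell property: the constant terms E_k(0) determine every coefficient. Strong induction on
    the recurrence, with [mul_bin_bin] moving the factor C(n, j) out of the sum. *)
Lemma coef_euler n j :
  (euler n)`_j = if (j <= n)%N then ('C(n, j))%:R * euler0 (n - j) else 0.
Proof.
elim/ltn_ind: n => n IHn.
rewrite eulerE coefB coefXn coefZ coef_sum.
under eq_bigr => k _ do rewrite coefZ IHn //.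
case: ifP => jn; last first.
  rewrite gtn_eqF ?big1 ?mulr0 ?subrr //; last by rewrite ltnNge jn.
    by move=> k _; rewrite ifN ?mulr0 //; have := ltn_ord k; lia.
have [d ->] : exists d, n = (j + d)%N by exists (n - j)%N; rewrite subnKC.
rewrite addKn euler0E big_split_ord /=.
rewrite big1 ?add0r => [|i _]; last by rewrite leqNgt ltn_ord mulr0.
rewrite -{1}[j]addn0 eqn_add2l [0%N == d]eq_sym mulrBr mulrCA [X in _ = _ - 2^-1 * X]mulr_sumr.
congr (_ - _ * _); first by case: d => [|d]; rewrite ?addn0 ?binn ?mulr1 ?mulr0.
apply: eq_bigr => k _; rewrite leq_addr addKn !mulrA -!natrM mul_bin_bin //.
exact: ltnW.
Qed.

(** * The series of tanh(t/2) and its addition law *)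

(* The Taylor coefficients of tanh(t/2) = 1 - 2/(e^t + 1). *)
Definition tanh_taylor (k : nat) : rat := (k == 0%N)%:R - euler0 k / k`!%:R.
Definition tanh_trunc (M : nat) : {poly rat} := \poly_(k < M) tanh_taylor k.

(** The relation tanh(t/2) (e^t + 1) = e^t - 1; coefficientwise it is the recurrence [euler0E]
    divided by k!. *)
Lemma tanh_exp_trunc M :
  'X^M %| tanh_trunc M * (exp_trunc M + 1) - (exp_trunc M - 1).
Proof.
apply/dvdXnP => k kM; rewrite mulrDr mulr1 !coefB coefD coef1 coefM !coef_poly kM.
have f0 := fact_rat_neq0.
have -> : \sum_(j < k.+1) (tanh_trunc M)`_j * (exp_trunc M)`_(k - j) =
    \sum_(j < k.+1) (((j : nat) == 0%N)%:R / k`!%:R - k`!%:R^-1 * ('C(k, j)%:R * euler0 j)).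
  apply: eq_bigr => j _; have jk : (j <= k)%N by rewrite -ltnS.
  rewrite !coef_poly (leq_ltn_trans jk kM) (leq_ltn_trans (leq_subr _ _) kM).
  rewrite mulrBl; congr (_ - _).
    by case: (nat_of_ord j) => [|?]; rewrite ?subn0 ?mul0r.
  have b0 : 'C(k, j)%:R != 0 :> rat by rewrite pnatr_eq0 -lt0n bin_gt0.
  by rewrite -(bin_fact jk) !natrM; field; rewrite !f0 b0.
rewrite sumrB -mulr_suml -mulr_sumr big_ord_recl big1 // [X in _ - _ * X]big_ord_recr /=.
rewrite addr0 binn [1 * euler0 k]mul1r; set S := \sum_(i < k) _.
have eS : S = 2 * ((k == 0%N)%:R - euler0 k) by rewrite euler0E -/S; field.
rewrite {S}eS /tanh_taylor; have := f0 k; case: k {kM} => [|k].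
  by rewrite fact0 => _; field.
by move: (_`!)%:R => F F0 /=; field.
Qed.

Lemma tanh_trunc_add M (x y : rat) :
  'X^M %| (tanh_trunc M \Po ((x + y) *: 'X))
            * (1 + (tanh_trunc M \Po (x *: 'X)) * (tanh_trunc M \Po (y *: 'X)))
          - ((tanh_trunc M \Po (x *: 'X)) + (tanh_trunc M \Po (y *: 'X))).
Proof.
(* For positive [M] the truncated exponential has constant term 1, so [E z + 1] has constant term 2,
   which is what coprimality to ['X^M] requires. *)
case: M => [|M]; first by rewrite expr0 dvd1p.
move: (M.+1) (ltn0Sn M) => {}M M0.
pose T z := tanh_trunc M \Po (z *: 'X); rewrite -/(T x) -/(T y) -/(T (x + y)).
pose E z := exp_trunc M \Po (z *: 'X).
have ET z : 'X^M %| T z * (E z + 1) - (E z - 1).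
  have := dvdXn_dilate _ _ _ z (tanh_exp_trunc M).
  by rewrite !(comp_polyB, comp_polyM, comp_polyD, comp_polyC, rmorph1).
have cE z : coprimep 'X^M (E z + 1).
  rewrite coprimep_sym coprimep_expr // coprimepX /root horner_coef0 coefD coef1.
  by rewrite coef_dilate coef_poly M0.
(* Clear denominators: E x + 1, E y + 1 and E (x + y) + 1 are units modulo 'X^M. *)
rewrite -(Gauss_dvdpr _ (cE x)) -(Gauss_dvdpr _ (cE y)) -(Gauss_dvdpr _ (cE (x + y))).
have E0 : 'X^M %| E x * E y - E (x + y) := exp_trunc_add M x y.
(* Eliminating [T x], [T y] and [T (x + y)] in turn by the relations [ET] leaves 4 (E(x+y) - E(x)
   E(y)), whence the last summand. *)
have -> : (E (x + y) + 1) * ((E y + 1) * ((E x + 1) *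
    (T (x + y) * (1 + T x * T y) - (T x + T y)))) =
  (T x * (E x + 1) - (E x - 1)) *
     (T (x + y) * (E (x + y) + 1) * (T y * (E y + 1)) - (E (x + y) + 1) * (E y + 1))
  + (T y * (E y + 1) - (E y - 1)) *
     (T (x + y) * (E (x + y) + 1) * (E x - 1) - (E (x + y) + 1) * (E x + 1))
  + (T (x + y) * (E (x + y) + 1) - (E (x + y) - 1)) *
     ((E x + 1) * (E y + 1) + (E x - 1) * (E y - 1))
  + (E x * E y - E (x + y)) * (- 4%:R) by ring.
by rewrite !dvdp_add // dvdp_mulr.
Qed.

Lemma tanh_taylor0 : tanh_taylor 0 = 0.
Proof. by rewrite /tanh_taylor /euler0 /= coef1 divr1 subrr. Qed.

(** Oddness of tanh comes from the addition law at x = 1, y = -1: the left factor vanishes, so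
    tanh(t/2) + tanh(-t/2) = 0. *)
Lemma tanh_taylor_even k : ~~ odd k -> tanh_taylor k = 0.
Proof.
move=> ek; have := tanh_trunc_add k.+1 1 (-1).
have -> : tanh_trunc k.+1 \Po ((1 - 1) *: 'X) = 0.
  apply/polyP => i; rewrite coef_dilate coef0 subrr coef_poly expr0n.
  by case: i => [|i]; rewrite ?mulr0 //= tanh_taylor0 mul0r.
move=> /dvdXnP/(_ _ (ltnSn k)).
rewrite mul0r sub0r coefN coefD !coef_dilate coef_poly ltnSn expr1n.
rewrite -signr_odd (negPf ek) expr0 mulr1 => /eqP.
by rewrite oppr_eq0 -mulr2n mulrn_eq0 => /eqP.
Qed.

Definition tanh_coef (m : nat) : rat := tanh_taylor m.*2.+1.

(** An odd series is t times a series in t^2; this form lets products be expanded over the odd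
    exponents alone. *)
Lemma tanh_trunc_odd M (x : rat) :
  tanh_trunc M.*2 \Po (x *: 'X) =
  x *: 'X * ((\poly_(m < M) tanh_coef m \Po ((x ^+ 2) *: 'X)) \Po 'X^2).
Proof.
apply/polyP => k; rewrite coef_dilate coef_poly -scalerAl coefZ coefXM.
case: k => [|k] /=; first by rewrite tanh_taylor0 mulr0; case: ifP; rewrite mul0r.
rewrite coef_comp_poly_Xn // coef_dilate coef_poly dvdn2.
case: (boolP (odd k)) => ok /=.
  by rewrite tanh_taylor_even ?if_same ?mul0r ?mulr0 //= negbK.
have [j ->] : exists j, k = j.*2 by exists k./2; rewrite -[LHS]odd_double_half (negPf ok).
rewrite -muln2 mulnK // muln2 ltn_Sdouble; case: ifP => _; last by rewrite !mul0r mulr0.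
by rewrite mulrCA -exprM mul2n -exprS.
Qed.

(** The component of degree 2d+1 of the addition law. The index [c] is the sum of the indices of the
    factors in x and y. *)
Lemma tanh_coef_add d (x y : rat) :
  tanh_coef d * (x ^+ d.*2.+1 + y ^+ d.*2.+1) =
  tanh_coef d * (x + y) ^+ d.*2.+1 +
  \sum_(c < d) \sum_(i < c.+1)
     tanh_coef (d.-1 - c) * tanh_coef i * tanh_coef (c - i) *
     (x ^+ i.*2.+1 * y ^+ (c - i).*2.+1 * (x + y) ^+ (d.-1 - c).*2.+1).
Proof.
(* Truncation at degree 2M = 2d+2 retains the coefficient of degree 2d+1. *)
pose M := d.+1.
pose S (z : rat) := \poly_(m < M) tanh_coef m \Po ((z ^+ 2) *: 'X).
have cT z : (tanh_trunc M.*2 \Po (z *: 'X))`_(d.*2.+1) = tanh_coef d * z ^+ d.*2.+1.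
  by rewrite coef_dilate coef_poly ifT // /M; lia.
have /dvdXnP/(_ d.*2.+1) := tanh_trunc_add M.*2 x y.
rewrite ltn_Sdouble ltnSn => /(_ isT); rewrite coefB mulrDr mulr1 !coefD !cT -mulrDr.
move/eqP; rewrite subr_eq0 => /eqP <-; congr (_ + _).
rewrite !tanh_trunc_odd -/(S x) -/(S y) -/(S (x + y)).
(* Three odd factors give t^3 times a series in t^2, so the coefficient of degree d-1 of the product
   of the [S] is wanted, and none for d = 0. *)
have -> : (x + y) *: 'X * (S (x + y) \Po 'X^2) *
    (x *: 'X * (S x \Po 'X^2) * (y *: 'X * (S y \Po 'X^2))) =
    ((x + y) * x * y) *: ('X * (('X * (S x * S y * S (x + y))) \Po 'X^2)).
  rewrite !comp_polyM comp_polyX -!mul_polyC !polyCM polyCD; ring.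
rewrite coefZ coefXM /= coef_comp_poly_Xn // dvdn2 odd_double /= -muln2 mulnK // coefXM.
case: d @M @S {cT} => [|d] M S /=; first by rewrite big_ord0 mulr0.
rewrite coefM mulr_sumr; apply: eq_bigr => c _.
rewrite coefM mulr_suml mulr_sumr; apply: eq_bigr => i _.
rewrite !coef_dilate !coef_poly !ifT; try by have := ltn_ord c; have := ltn_ord i; rewrite /M; lia.
by rewrite -!exprM !mul2n !exprS; ring.
Qed.

(** * Rising factorials and the Beta linear form *)

Definition rising {R : nzRingType} (u : R) (k : nat) : R := \prod_(j < k) (u + j%:R).

Lemma rising0 (R : nzRingType) (u : R) : rising u 0 = 1.
Proof. exact: big_ord0. Qed.

Lemma risingSr (R : nzRingType) (u : R) k :
  rising u k.+1 = rising u k * (u + k%:R).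
Proof. exact: big_ord_recr. Qed.

Lemma risingSl (R : nzRingType) (u : R) k :
  rising u k.+1 = u * rising (u + 1) k.
Proof.
rewrite /rising big_ord_recl addr0; congr (_ * _).
by apply: eq_bigr => j _; rewrite -addrA nat1r.
Qed.

(** The falling factorial read from its smallest factor upwards; for k > P both sides contain the
    factor 0. *)
Lemma rising_ffact (R : comNzRingType) (P k : nat) :
  rising (P%:R - k%:R + 1 : R) k = (P ^_ k)%:R.
Proof.
elim: k => [|k IHk]; first by rewrite rising0 ffactn0.
rewrite risingSl -[k.+1]addn1 natrD opprD addrA subrK IHk addn1 ffactnSr mulrC.
case: (leqP k P) => [kP|Pk]; first by rewrite natrM natrB.
by rewrite ffact_small // mul0r mul0n.
Qed.

Lemma rising_opp_ffact (R : comNzRingType) (Q k : nat) :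
  rising (- Q%:R : R) k = (-1) ^+ k * (Q ^_ k)%:R.
Proof.
elim: k => [|k IHk]; first by rewrite rising0 ffactn0 mul1r.
rewrite risingSr IHk ffactnSr exprSr natrM.
case: (leqP k Q) => [kQ|Qk]; first by rewrite natrB //; ring.
by rewrite ffact_small // !(mulr0, mul0r).
Qed.

(* Up to a factor depending only on N, the integral of p(x/y) y^N against the
   Beta weight x^(u-1) y^(v-1) on x + y = 1; polynomial in u and v, so the
   parameters need not be positive. *)
Definition beta_form {R : comNzRingType} (u v : R) (N : nat) (p : {poly R}) : R :=
  \sum_(j < N.+1) p`_j * (rising u j * rising v (N - j)).

Lemma beta_formD (R : comNzRingType) (u v : R) N p q :
  beta_form u v N (p + q) = beta_form u v N p + beta_form u v N q.
Proof. by rewrite -big_split; apply: eq_bigr => j _; rewrite coefD mulrDl. Qed.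

Lemma beta_formZ (R : comNzRingType) (u v : R) N a p :
  beta_form u v N (a *: p) = a * beta_form u v N p.
Proof. by rewrite mulr_sumr; apply: eq_bigr => j _; rewrite coefZ mulrA. Qed.

Lemma beta_form_sum (R : comNzRingType) (u v : R) N n (F : 'I_n -> {poly R}) :
  beta_form u v N (\sum_i F i) = \sum_i beta_form u v N (F i).
Proof.
apply: (big_morph (beta_form u v N)); first exact: beta_formD.
by rewrite /beta_form big1 // => j _; rewrite coef0 mul0r.
Qed.

Lemma beta_formXn (R : comNzRingType) (u v : R) N i : (i <= N)%N ->
  beta_form u v N 'X^i = rising u i * rising v (N - i).
Proof.
rewrite -ltnS => iN; rewrite /beta_form (bigD1 (Ordinal iN)) //= coefXn eqxx mul1r.
rewrite big1 ?addr0 // => j ji; move: ji; rewrite -val_eqE /= coefXn => /negPf->.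
by rewrite mul0r.
Qed.

(** Vandermonde by induction on [k]: splitting off one factor ['X + 1] gives two terms differing
    only in u + i and v + M, where M = N - k - 1 - i in the inductive step. Their sum u + v + M + i
    is the first factor of the longer rising factorial. *)
Lemma beta_formXnD1 (R : comNzRingType) (u v : R) N i k : (i + k <= N)%N ->
  beta_form u v N ('X^i * ('X + 1) ^+ k) =
  rising u i * rising v (N - k - i) * rising (u + v + (N - k)%:R) k.
Proof.
elim: k i => [|k IHk] i ikN.
  by rewrite expr0 mulr1 beta_formXn ?subn0 ?rising0 ?mulr1 // -[i]addn0.
have -> : 'X^i * ('X + 1) ^+ k.+1 =
    'X^(i.+1) * ('X + 1) ^+ k + 'X^i * ('X + 1) ^+ k :> {poly R}.
  by rewrite !exprS; ring.
rewrite beta_formD !IHk; try lia.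
have [M eN] : exists M, N = (M + i + k.+1)%N by exists (N - k.+1 - i)%N; lia.
have -> : (N - k - i.+1)%N = M by lia.
have -> : (N - k - i)%N = M.+1 by lia.
have -> : (N - k.+1 - i)%N = M by lia.
have -> : (N - k.+1)%N = (M + i)%N by lia.
have -> : (N - k)%N = (M + i).+1 by lia.
rewrite (risingSr _ u) (risingSr _ v) risingSl -[_ + _ + 1]addrA natr1 natrD; ring.
Qed.

Lemma poly_rat_ext (p q : {poly rat}) : (forall x, p.[x] = q.[x]) -> p = q.
Proof.
move=> pq; apply/eqP; rewrite -subr_eq0; apply/eqP.
apply: (@roots_geq_poly_eq0 _ _ [seq n%:R | n <- iota 0 (size (p - q))]).
- by apply/allP => x _; rewrite /root !hornerE pq subrr.
- by rewrite map_inj_uniq ?iota_uniq //; apply: mulrIn; apply: oner_neq0.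
- by rewrite size_map size_iota.
Qed.

Lemma tanh_coef_rising d (u v : rat) :
  tanh_coef d * (rising u d.*2.+1 + rising v d.*2.+1) =
  tanh_coef d * rising (u + v) d.*2.+1 +
  \sum_(c < d) \sum_(i < c.+1)
     tanh_coef (d.-1 - c) * tanh_coef i * tanh_coef (c - i) *
     (rising u i.*2.+1 * rising v (c - i).*2.+1
      * rising (u + v + (c.+1.*2)%:R) (d.-1 - c).*2.+1).
Proof.
(* The addition law is dehomogenised at y = 1. The powers ['X^0] are kept so that the monomial
   formulas for [beta_form] apply. *)
have /poly_rat_ext e : forall x : rat,
   (tanh_coef d *: ('X^(d.*2.+1) + 'X^0)).[x] =
   (tanh_coef d *: ('X^0 * ('X + 1) ^+ d.*2.+1) +
   \sum_(c < d) \sum_(i < c.+1)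
     (tanh_coef (d.-1 - c) * tanh_coef i * tanh_coef (c - i)) *:
     ('X^(i.*2.+1) * ('X + 1) ^+ (d.-1 - c).*2.+1)).[x].
  move=> x; have := tanh_coef_add d x 1.
  rewrite expr1n expr0 mul1r !(hornerE, horner_exp) /= => ->; congr (_ + _).
  rewrite horner_sum; apply: eq_bigr => c _; rewrite horner_sum; apply: eq_bigr => i _.
  by rewrite !(hornerE, horner_exp) expr1n /= mulr1.
have := congr1 (beta_form u v d.*2.+1) e.
rewrite !(beta_formD, beta_formZ) !beta_formXn // beta_formXnD1 //.
rewrite beta_form_sum !subnn !subn0 !rising0 mul1r !mulr1 addr0 => ->; rewrite mul1r; congr (_ + _).
apply: eq_bigr => c _; rewrite beta_form_sum; apply: eq_bigr => i _.
have := ltn_ord c; have := ltn_ord i => ic cd.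
rewrite beta_formZ beta_formXnD1; last by lia.
by congr (_ * (_ * rising _ _ * rising (_ + _%:R) _)); lia.
Qed.

(** * Closed form of the r-binomials *)

Lemma coef_Xn_sub_euler P k : (0 < k <= P)%N ->
  ('X^P - euler P)`_(P - k) = tanh_taylor k * (P ^_ k)%:R.
Proof.
case/andP=> k0 kP; rewrite coefB coefXn coef_euler leq_subr subKn // bin_sub //.
rewrite ltn_eqF ?ltn_subLR //; try lia.
rewrite -bin_ffact natrM /tanh_taylor gtn_eqF //.
have f0 := fact_rat_neq0 k.
by rewrite /=; field.
Qed.

(** With the lower index written N - m, the value 0 prescribed out of range is that of a falling
    factorial longer than its base. The same holds for [ebraceE]. *)
Lemma ebrackE (N m : nat) :
  ebrack N%:Z (N%:Z - m%:Z) = tanh_coef m * ((2 * N) ^_ m.*2.+1)%:R.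
Proof.
rewrite /ebrack; case: ifPn => cond.
  rewrite -coef_Xn_sub_euler; last by lia.
  by rewrite absz_nat; congr (_`_ _); lia.
by rewrite ffact_small ?mulr0 //; lia.
Qed.

Lemma ebraceE (N m : nat) :
  ebrace N%:Z (N%:Z - m%:Z) = tanh_coef m * ((2 * N).+1 ^_ m.*2.+1)%:R.
Proof.
rewrite /ebrace; case: ifPn => cond.
  rewrite -coef_Xn_sub_euler; last by lia.
  by rewrite absz_nat; congr (_`_ _); lia.
by rewrite ffact_small ?mulr0 //; lia.
Qed.

Lemma rbinom_small (r n i : int) : n < i -> rbinom r n i = 0.
Proof. by rewrite /rbinom => ->; rewrite orbT. Qed.

(** The rising factorial is the product of r+2i, r+2i+2-1, ..., r+2n, taken over consecutive
    integers. If r+2n >= 0 it is a falling factorial from r+2n; otherwise all factors are negative,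
    and their odd number produces the minus sign of the definition. *)
Lemma rbinomE (r : int) (n i : nat) : (i <= n)%N ->
  rbinom r n%:Z i%:Z =
  tanh_coef (n - i) * rising (r%:~R + (2 * i)%:R) (n - i).*2.+1.
Proof.
move=> le_in; have [m en] : exists m, n = (i + m)%N by exists (n - i)%N; lia.
have -> : (n - i)%N = m by lia.
have top (P : nat) : r + (2 * n)%:Z = P%:Z ->
    rising (r%:~R + (2 * i)%:R : rat) m.*2.+1 = (P ^_ m.*2.+1)%:R.
  move=> eP; rewrite -rising_ffact; congr rising.
  have -> : r = P%:Z - (2 * n)%:Z by rewrite -eP addrK.
  by rewrite en rmorphB /= -mul2n; ring.
have bot (Q : nat) : - r - (2 * i)%:Z = Q%:Z ->
    rising (r%:~R + (2 * i)%:R : rat) m.*2.+1 = - (Q ^_ m.*2.+1)%:R.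
  move=> eQ; have -> : r%:~R + (2 * i)%:R = - Q%:R :> rat.
    have -> : r = - (Q%:Z + (2 * i)%:Z) by rewrite -eQ subrK opprK.
    by rewrite rmorphN rmorphD /= -!pmulrn; ring.
  by rewrite rising_opp_ffact -signr_odd /= odd_double mulN1r.
rewrite /rbinom ifF; last by lia.
set h := (r %/ 2)%Z; have er : r = h * 2 + (r %% 2)%Z := divz_eq r 2.
have rm : 0 <= (r %% 2)%Z < 2 by rewrite modz_ge0 //= ltz_pmod.
case: ifPn => ev; case: ifPn => le_hn; rewrite ?mulrN.
- have [N eN] : exists N : nat, h + n%:Z = N by exists (absz (h + n)); lia.
  rewrite (top (2 * N)%N); last by lia.
  by rewrite -ebrackE; congr ebrack; lia.
- have [N eN] : exists N : nat, - h - i%:Z = N by exists (absz (- h - i)); lia.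
  rewrite (bot (2 * N)%N); last by lia.
  by rewrite mulrN -ebrackE; congr (- ebrack _ _); lia.
- have [N eN] : exists N : nat, h + n%:Z = N by exists (absz (h + n)); lia.
  rewrite (top (2 * N).+1%N); last by lia.
  by rewrite -ebraceE; congr ebrace; lia.
- have [N eN] : exists N : nat, - h - 1 - i%:Z = N by exists (absz (- h - 1 - i%:Z)%R); lia.
  rewrite (bot (2 * N).+1%N); last by lia.
  by rewrite mulrN -ebraceE; congr (- ebrace _ _); lia.
Qed.

(** * The convolution identity, by matching index ranges *)

Theorem theorem6p1 (n alpha beta : nat) (r s : int) :
  rbinom r (n%:Z - beta%:Z) alpha%:Z + rbinom s (n%:Z - alpha%:Z) beta%:Z =
  rbinom (r + s) n%:Z (alpha + beta)%N%:Z +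
  \sum_(k < n.+1) \sum_(l < k)
     rbinom (r + s) n%:Z k%:Z * rbinom r l%:Z alpha%:Z
       * rbinom s (k - 1 - l)%N%:Z beta%:Z.
Proof.
(* For n < alpha + beta every term vanishes: l + m = k - 1 < alpha + beta forces l < alpha or m <
   beta. *)
case: (ltnP n (alpha + beta)) => [lt_n|le_n].
  rewrite !rbinom_small; try lia.
  rewrite big1 ?addr0 // => k _; rewrite big1 // => l _.
  have := ltn_ord k; have := ltn_ord l => lk kn.
  case: (ltnP l alpha) => la; first by rewrite (rbinom_small r) ?mulr0 ?mul0r //; lia.
  by rewrite (rbinom_small s) ?mulr0 //; lia.
have [d en] : exists d, n = (alpha + beta + d)%N by exists (n - (alpha + beta))%N; lia.
pose u : rat := r%:~R + (2 * alpha)%:R; pose v : rat := s%:~R + (2 * beta)%:R.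
have -> : n%:Z - beta%:Z = (alpha + d)%N by lia.
have -> : n%:Z - alpha%:Z = (beta + d)%N by lia.
have euv k : (r + s)%:~R + (2 * (alpha + beta + k))%:R = u + v + k.*2%:R.
  by rewrite /u /v rmorphD -mul2n !natrM !natrD; ring.
rewrite !rbinomE ?leq_addr // !addKn -/u -/v -mulrDr tanh_coef_rising.
have -> : (n - (alpha + beta))%N = d by lia.
rewrite -[(alpha + beta)%N]addn0 euv addr0; congr (_ + _).
have vanish (k l : nat) : (l < k)%N -> (l < alpha)%N || (k - 1 - l < beta)%N ->
    rbinom (r + s) n%:Z k%:Z * rbinom r l%:Z alpha%:Z
      * rbinom s (k - 1 - l)%N%:Z beta%:Z = 0.
  move=> lk /orP[la|mb]; first by rewrite (rbinom_small r) ?mulr0 ?mul0r //; lia.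
  by rewrite (rbinom_small s) ?mulr0 //; lia.
(* The surviving indices are k = alpha + beta + 1 + c with c < d and l = alpha + i with i <= c, as
   in [tanh_coef_rising]. *)
have -> : n.+1 = ((alpha + beta).+1 + d)%N by lia.
rewrite big_split_ord /= [X in _ = X + _]big1 ?add0r => [|k _]; last first.
  by apply: big1 => l _; apply: vanish => //; have := ltn_ord k; have := ltn_ord l; lia.
apply: eq_bigr => c _.
(* The range of l is cut into three blocks: in the first l < alpha, in the last k - 1 - l < beta. *)
have -> : ((alpha + beta).+1 + c)%N = (alpha + (c.+1 + beta))%N by lia.
rewrite !big_split_ord /= [X in _ = X + _]big1 ?add0r => [|l _]; last first.
  by apply: vanish; have := ltn_ord l; lia.
rewrite [X in _ = _ + X]big1 ?addr0 => [|l _]; last first.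
  by apply: vanish; have := ltn_ord l; lia.
apply: eq_bigr => i _; have ic := ltn_ord i; have cd := ltn_ord c.
have -> : (alpha + (c.+1 + beta) - 1 - (alpha + i))%N = (beta + (c - i))%N by lia.
rewrite !rbinomE ?leq_addr //; last by lia.
have -> : (alpha + (c.+1 + beta))%N = (alpha + beta + c.+1)%N by lia.
rewrite euv -/u -/v !addKn.
have -> : (n - (alpha + beta + c.+1))%N = (d.-1 - c)%N by lia.
by ring.
Qed.
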